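(* Let $\lambda\in\mathbb{R}$, let $Y$ be a binomial random variable with parameters $m$ and $p>0$, and let $x\in[0,1]$. For all integers $n\ge k\ge 0$, \[ \frac{B_{k,n}^{Y}(x|\lambda)}{k!}=\binom{n}{k}\binom{x}{k}_{\lambda}\sum_{j=0}^{n-k}\binom{m(1-x)}{j}j!\,p^{j}{n-k \brace j}_{\lambda}. \]
   Context: For $\lambda\in\mathbb{R}$, $(x)_{0,\lambda}=1$, $(x)_{n,\lambda}=x(x-\lambda)\cdots(x-(n-1)\lambda)$ for $n\ge1$, $\binom{x}{k}_\lambda=\frac{(x)_{k,\lambda}}{k!}$, and $e_\lambda^x(t)=\sum_{n\ge0}(x)_{n,\lambda}\frac{t^n}{n!}$. The degenerate Stirling numbers of the second kind are given by $(x)_{n,\lambda}=\sum_{k=0}^n{n\brace k}_\lambda (x)_k$, where $(x)_k=x(x-1)\cdots(x-k+1)$. For the random variable $Y$, $E[e_\lambda^Y(t)]$ denotes the power series $\sum_{n\ge0}E[(Y)_{n,\lambda}]\frac{t^n}{n!}$ (constant term $1$); for real $a$, $(E[e_\lambda^Y(t)])^a=\sum_{j\ge0}\binom{a}{j}(E[e_\lambda^Y(t)]-1)^j$. The probabilistic degenerate Bernstein polynomials: $\frac{1}{k!}(x)_{k,\lambda}t^k(E[e_\lambda^Y(t)])^{1-x}=\sum_{n\ge k}B_{k,n}^{Y}(x|\lambda)\frac{t^n}{n!}$. *)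

(* Defs.v *)
From HB Require Import structures.
From mathcomp Require Export all_boot all_order all_algebra.
From mathcomp Require Export all_classical all_reals all_analysis.

Set Implicit Arguments.
Unset Strict Implicit.
Unset Printing Implicit Defensive.

Import Order.TTheory GRing.Theory Num.Theory.
Import numFieldNormedType.Exports.

Local Open Scope classical_set_scope.
Local Open Scope ring_scope.

Section degenerate_factorials.
Context {R : realType}.
Implicit Types (lambda x : R) (k n : nat).

(* (x)_k = x (x - 1) ... (x - k + 1) *)
Definition fallfact x k : R := \prod_(i < k) (x - i%:R).

(* (x)_{n, lambda} = x (x - lambda) ... (x - (n - 1) lambda) *)
Definition deg_fallfact lambda x n : R := \prod_(i < n) (x - i%:R * lambda).

Definition gbinom x k : R := fallfact x k / k`!%:R.

Definition deg_binom lambda x k : R := deg_fallfact lambda x k / k`!%:R.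

(* The numbers S n k with k <= n are uniquely determined by this identity, *)
(* the falling factorials being linearly independent functions of x.      *)
Definition deg_stirling2 lambda (S : nat -> nat -> R) : Prop :=
  forall n x,
    deg_fallfact lambda x n = \sum_(k < n.+1) S n k * fallfact x k.

Lemma deg_stirling2_exists lambda : exists S, deg_stirling2 lambda S.
Proof.
pose S := fix S n k : R := match n with
  | 0 => (k == 0%N)%:R
  | n'.+1 => (if k is k'.+1 then S n' k' else 0)
             + (k%:R - n'%:R * lambda) * S n' k
  end.
exists S.
have S0 n k : (n < k)%N -> S n k = 0.
  elim: n k => [|n IH] [|k]//= nk.
  by rewrite !IH ?mulr0 ?addr0// ltnW.
move=> n x; elim: n => [|n IH].
  by rewrite /deg_fallfact /fallfact big_ord0 big_ord1 big_ord0 mul1r.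
rewrite /deg_fallfact big_ord_recr/= -/(deg_fallfact _ _ _) IH.
under [RHS]eq_bigr do rewrite mulrDl.
rewrite big_split/=.
rewrite [X in _ = X + _]big_ord_recl/= mul0r add0r.
rewrite [X in _ = _ + X]big_ord_recr/= S0// mulr0 mul0r addr0.
rewrite mulr_suml -big_split/=; apply: eq_bigr => i _.
rewrite /bump/= add1n add0n /fallfact big_ord_recr/= -mulrA -[_ * S n i * _]mulrA.
rewrite [(_ - _) * (S n i * _)]mulrC -[S n i * _ * (_ - _)]mulrA -mulrDr -mulrDr.
by congr (_ * (_ * _)); rewrite addrA subrK.
Qed.

End degenerate_factorials.

(* A formal power series sum_n (f n) t^n is represented by its sequence of *)
(* ordinary coefficients.                                                  *)
Section formal_power_series.
Context {R : realType}.
Implicit Types (f g : nat -> R) (a : R) (j k n : nat).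

Definition fps_Xn k : nat -> R := fun n => (n == k)%:R.

Definition fps_mul f g : nat -> R := fun n => \sum_(i < n.+1) f i * g (n - i)%N.

Definition fps_exp f j : nat -> R := iter j (fps_mul f) (fps_Xn 0).

Definition fps_sub1 f : nat -> R := fun n => f n - fps_Xn 0 n.

(* f ^ a = sum_(j >= 0) binom(a, j) (f - 1) ^ j, for f with constant term 1. *)
(* The terms with j > n do not contribute to the coefficient of t ^ n, see   *)
(* fps_exp_sub1_small, whence the bound on j.                                *)
Definition fps_powr f a : nat -> R := fun n =>
  \sum_(j < n.+1) gbinom a j * fps_exp (fps_sub1 f) j n.

Lemma fps_exp_sub1_small f j n : f 0%N = 1 -> (n < j)%N ->
  fps_exp (fps_sub1 f) j n = 0.
Proof.
move=> f0; elim: j n => // j IH n nj.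
rewrite /fps_exp iterS -/(fps_exp _ _) /fps_mul big1// => -[[|i] iltn] _ /=.
  by rewrite /fps_sub1 f0 /fps_Xn eqxx subrr mul0r.
rewrite IH ?mulr0// (leq_trans _ (nj : (n <= j)%N))// ltn_subrL//=.
by rewrite (leq_ltn_trans _ (iltn : (i < n)%N)).
Qed.

End formal_power_series.

Section probabilistic_degenerate_bernstein.
Context {d : measure_display} {T : measurableType d} {R : realType}.
Context (P : probability T R).
Implicit Types (Y : {RV P >-> R}) (lambda p x : R) (k m n : nat).

(* binomial_prob is a measure on nat: the law of Y on the Borel sets of R is *)
(* its image under the inclusion of nat in R.                                *)
Definition binomial_rv Y m p : Prop := forall A : set R, measurable A ->
  distribution P Y A = binomial_prob m p [set i : nat | A i%:R].

(* E[e_lambda^Y(t)] *)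
Definition deg_expectation Y lambda : nat -> R := fun n =>
  fine 'E_P[fun w => deg_fallfact lambda (Y w) n]%E / n`!%:R.

Lemma deg_expectation0 Y lambda : deg_expectation Y lambda 0 = 1.
Proof.
rewrite /deg_expectation [X in 'E_P[X]%E](_ : _ = cst 1); last first.
  by apply/funext => w; rewrite /deg_fallfact big_ord0.
by rewrite expectation_cst/= fact0 divr1.
Qed.

(* (1 / k!) (x)_{k, lambda} t^k (E[e_lambda^Y(t)])^(1 - x) *)
Definition deg_bernstein_gf Y lambda k x : nat -> R := fun n =>
  (k`!%:R)^-1 * deg_fallfact lambda x k
  * fps_mul (fps_Xn k) (fps_powr (deg_expectation Y lambda) (1 - x)) n.

(* B_{k, n}^Y(x | lambda), the coefficient of t^n / n! in deg_bernstein_gf *)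
Definition deg_bernstein Y lambda k n x : R :=
  n`!%:R * deg_bernstein_gf Y lambda k x n.

Lemma deg_bernstein_small Y lambda k n x : (n < k)%N ->
  deg_bernstein Y lambda k n x = 0.
Proof.
move=> nk; rewrite /deg_bernstein /deg_bernstein_gf /fps_mul big1 ?mulr0//.
move=> i _; rewrite /fps_Xn ltn_eqF ?mul0r//.
by rewrite (leq_ltn_trans _ nk)// -ltnS.
Qed.

End probabilistic_degenerate_bernstein.

(* Main.v *)
From mathcomp Require Import unstable measurable_realfun.
From mathcomp Require Import measurable_fun_approximation ring.
Require Import Defs.

Import Order.TTheory GRing.Theory Num.Theory.
Import numFieldNormedType.Exports.
Local Open Scope ring_scope.

(* Put e = sum_n (1)_{n,lambda} t^n / n!, so that e^i has coefficients
   (i)_{n,lambda} / n! by a Vandermonde identity. For Y binomial,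
   E[e_lambda^Y(t)] = (1 + p (e - 1))^m, and binomial inversion gives
   (e - 1)^j = j! sum_n {n brace j}_lambda t^n / n!. The claim thus amounts to
   ((1 + u)^m)^a = (1 + u)^(m a) with u = p (e - 1) and a = 1 - x.
   Coefficientwise, both sides are polynomials in a that agree at every
   natural number a. Power series are replaced by polynomials agreeing with
   them up to the degree of interest. *)

(** * Degenerate binomial coefficients and powers of truncated series *)

Lemma deg_binom0 {R : realType} (l x : R) : deg_binom l x 0 = 1.
Proof. by rewrite /deg_binom /deg_fallfact big_ord0 fact0 divr1. Qed.

Lemma deg_binomS {R : realType} (l x : R) n :
  n.+1%:R * deg_binom l x n.+1 = (x - n%:R * l) * deg_binom l x n.
Proof.
rewrite /deg_binom /deg_fallfact big_ord_recr/= factS natrM.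
by field; rewrite pnatr_eq0 -lt0n fact_gt0 -[1]/(1%:R) -natrD pnatr_eq0.
Qed.

Lemma deg_binomD {R : realType} (l x y : R) n :
  deg_binom l (x + y) n =
  \sum_(i < n.+1) deg_binom l x i * deg_binom l y (n - i).
Proof.
elim: n => [|n IH]; first by rewrite big_ord1 subnn !deg_binom0 mulr1.
have n1 : n.+1%:R != 0 :> R by rewrite pnatr_eq0.
apply: (mulfI n1); rewrite deg_binomS IH.
(* Splitting [n.+1] as [i + (n.+1 - i)] lets each summand be absorbed by one factor through
   [deg_binomS]. The terms with [i = 0] in the first sum and [i = n.+1] in the second vanish, which
   brings both back to [i <= n]. *)
pose a i := deg_binom l x i; pose b i := deg_binom l y i.
have -> : n.+1%:R * (\sum_(i < n.+2) a i * b (n.+1 - i)%N) =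
    \sum_(i < n.+2) i%:R * a i * b (n.+1 - i)%N
    + \sum_(i < n.+2) a i * ((n.+1 - i)%:R * b (n.+1 - i)%N).
  rewrite mulr_sumr -big_split/=; apply: eq_bigr => i _.
  rewrite [in LHS](_ : n.+1%:R = i%:R + (n.+1 - i)%:R); first by ring.
  by rewrite -natrD subnKC// -ltnS.
rewrite [X in _ = X + _]big_ord_recl/= !mul0r add0r.
rewrite [X in _ = _ + X]big_ord_recr/= subnn mul0r mulr0 addr0.
rewrite mulr_sumr -big_split/=; apply: eq_bigr => i _.
have ilen : (i <= n)%N by rewrite -ltnS.
rewrite /bump add1n subSS subSn// /a /b !deg_binomS natrB// -/(a i) -/(b _).
by ring.
Qed.

(** Multiplying by [e] is the Vandermonde identity [deg_binomD] with one argument 1. Coefficients of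
    a product up to [N] involve only those of its factors up to [N], so a truncation suffices. *)
Lemma coef_deg_binom_exp {R : realType} (l : R) N (e : {poly R}) :
  (forall n, (n <= N)%N -> e`_n = deg_binom l 1 n) ->
  forall i n, (n <= N)%N -> (e ^+ i)`_n = deg_binom l i%:R n.
Proof.
move=> eE; elim=> [|i IH] n nN.
  rewrite expr0 coef1 /deg_binom /deg_fallfact.
  case: n {nN} => [|n]; first by rewrite big_ord0 fact0 divr1.
  by rewrite big_ord_recl mul0r subr0 !mul0r.
rewrite exprS -natr1 addrC deg_binomD coefM; apply: eq_bigr => j _.
have jn : (j <= n)%N by rewrite -ltnS.
by rewrite eE ?(leq_trans jn)// IH// (leq_trans (leq_subr _ _)).
Qed.

Lemma coef_fps_exp {R : realType} (f : nat -> R) N (q : {poly R}) :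
  (forall n, (n <= N)%N -> q`_n = f n) ->
  forall j n, (n <= N)%N -> fps_exp f j n = (q ^+ j)`_n.
Proof.
move=> qE; elim=> [|j IH] n nN.
  by rewrite expr0 coef1 /fps_exp/= /fps_Xn.
rewrite exprS coefM /fps_exp iterS -/(fps_exp _ _) /fps_mul.
apply: eq_bigr => i _; have jn : (i <= n)%N by rewrite -ltnS.
by rewrite qE ?(leq_trans jn)// IH// (leq_trans (leq_subr _ _)).
Qed.

(** * Binomial transforms and Stirling numbers *)

Lemma fallfact_nat {R : realType} i j :
  fallfact (i%:R : R) j = (i ^_ j)%:R.
Proof.
elim: j => [|j IH]; first by rewrite /fallfact big_ord0.
rewrite /fallfact big_ord_recr/= -/(fallfact _ _) IH ffactnSr natrM.
have [ji|ij] := leqP j i; first by rewrite natrB.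
by rewrite ffact_small ?mul0r.
Qed.

Lemma gbinom_nat {R : realType} i j : gbinom (i%:R : R) j = 'C(i, j)%:R.
Proof.
have j0 : j`!%:R != 0 :> R by rewrite pnatr_eq0 -lt0n fact_gt0.
by rewrite /gbinom fallfact_nat -bin_ffact natrM mulfK.
Qed.

(** Beyond [M] the binomial coefficient vanishes, beyond [N] the sequence does. This gives binomial
    expansions of exponent [M] a range independent of [M]. *)
Lemma sum_bin_trunc {R : pzRingType} (c : nat -> R) N M :
  (forall j, (N < j)%N -> c j = 0) ->
  \sum_(j < M.+1) 'C(M, j)%:R * c j = \sum_(j < N.+1) 'C(M, j)%:R * c j.
Proof.
move=> c0; pose K := maxn M.+1 N.+1.
rewrite (big_ord_widen K (fun j => 'C(M, j)%:R * c j)) ?leq_maxl//.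
rewrite [RHS](big_ord_widen K (fun j => 'C(M, j)%:R * c j)) ?leq_maxr//.
rewrite big_mkcond [RHS]big_mkcond/=; apply: eq_bigr => j _.
case: ltnP => jM; case: ltnP => jN //; last by rewrite bin_small// mul0r.
by rewrite c0 ?mulr0.
Qed.

(** The transform is triangular with unit diagonal, since ['C(i, i) = 1]. *)
Lemma binomial_transform_inj {R : pzRingType} (c d : nat -> R) :
  (forall i, \sum_(j < i.+1) 'C(i, j)%:R * c j =
             \sum_(j < i.+1) 'C(i, j)%:R * d j) ->
  c =1 d.
Proof.
move=> cd i; elim/ltn_ind: i => i IH; have := cd i.
rewrite !big_ord_recr/= binn !mul1r.
by under eq_bigr do rewrite IH//; move/addrI.
Qed.

Lemma coef_expD1n {R : nzRingType} (q : {poly R}) M n :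
  ((q + 1) ^+ M)`_n = \sum_(j < M.+1) 'C(M, j)%:R * (q ^+ j)`_n.
Proof.
rewrite exprD1n coef_sum; apply: eq_bigr => j _.
by rewrite coefMn mulr_natl.
Qed.

(** Both sides have the same binomial transform: the coefficient of [e ^+ i] on the left, the
    Stirling expansion at [x = i] on the right. The case [N < j] is set to 0 because [deg_stirling2]
    leaves those [S N j] arbitrary. *)
Lemma deg_stirling2_coef {R : realType} (l : R) S N (e : {poly R}) :
  deg_stirling2 l S ->
  (forall n, (n <= N)%N -> e`_n = deg_binom l 1 n) ->
  forall j, ((e - 1) ^+ j)`_N =
    if (j <= N)%N then j`!%:R * S N j / N`!%:R else 0.
Proof.
move=> SP eE; apply: binomial_transform_inj => i.
rewrite -coef_expD1n subrK (coef_deg_binom_exp l N)// /deg_binom SP.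
pose D j : R := if (j <= N)%N then j`!%:R * S N j / N`!%:R else 0.
rewrite (sum_bin_trunc D N); last by move=> j; rewrite /D ltnNge => /negbTE ->.
rewrite mulr_suml; apply: eq_bigr => j _.
rewrite /D -ltnS ltn_ord fallfact_nat -bin_ffact natrM; ring.
Qed.

(** * Identities polynomial in the exponent, checked at natural numbers *)

Lemma poly_eq_nat {R : numDomainType} (q r : {poly R}) :
  (forall i : nat, q.[i%:R] = r.[i%:R]) -> q = r.
Proof.
move=> qr; apply/eqP; rewrite -subr_eq0; apply/negP => /negP qr0.
pose rs := [seq i%:R : R | i <- iota 0 (size (q - r))].
have rs_root : all (root (q - r)) rs.
  by apply/allP => _ /mapP[i _ ->]; rewrite rootE !hornerE qr subrr.
have rs_uniq : uniq rs.
  by rewrite map_inj_uniq ?iota_uniq// => i j /eqP; rewrite eqr_nat => /eqP.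
by have := max_poly_roots qr0 rs_root rs_uniq; rewrite size_map size_iota ltnn.
Qed.

Definition gbinom_poly {R : realType} j : {poly R} :=
  (j`!%:R)^-1 *: \prod_(i < j) ('X - (i%:R)%:P).

Lemma horner_gbinom_poly {R : realType} j (a : R) :
  (gbinom_poly j).[a] = gbinom a j.
Proof.
rewrite /gbinom_poly hornerZ horner_prod mulrC /gbinom /fallfact.
by congr (_ / _); apply: eq_bigr => i _; rewrite hornerXsubC.
Qed.

Lemma gbinom_sum_eq {R : realType} m (c d : nat -> R) N :
  (forall i : nat, \sum_(j < N.+1) 'C(i, j)%:R * c j =
                   \sum_(j < N.+1) 'C(m * i, j)%:R * d j) ->
  forall a, \sum_(j < N.+1) gbinom a j * c j =
            \sum_(j < N.+1) gbinom (m%:R * a) j * d j.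
Proof.
move=> cd a.
pose q : {poly R} := \sum_(j < N.+1) c j *: gbinom_poly j.
pose r : {poly R} := \sum_(j < N.+1) d j *: (gbinom_poly j \Po (m%:R *: 'X)).
have qE b : q.[b] = \sum_(j < N.+1) gbinom b j * c j.
  rewrite horner_sum; apply: eq_bigr => j _.
  by rewrite hornerZ horner_gbinom_poly mulrC.
have rE b : r.[b] = \sum_(j < N.+1) gbinom (m%:R * b) j * d j.
  rewrite horner_sum; apply: eq_bigr => j _.
  rewrite hornerZ horner_comp (hornerZ m%:R) hornerX horner_gbinom_poly.
  exact: mulrC.
rewrite -qE -rE; congr (_.[_]); apply: poly_eq_nat => i.
rewrite qE rE -natrM.
under eq_bigr do rewrite gbinom_nat.
by under [RHS]eq_bigr do rewrite gbinom_nat.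
Qed.

Lemma coef_fps_powr_binomial {R : realType} (l p : R) S m (f : nat -> R) N a :
  deg_stirling2 l S ->
  (forall n, f n =
    \sum_(i < m.+1) binomial_pmf m p i * deg_binom l i%:R n) ->
  f 0 = 1 ->
  N`!%:R * fps_powr f a N =
  \sum_(j < N.+1) gbinom (m%:R * a) j * j`!%:R * p ^+ j * S N j.
Proof.
move=> SP fE f0.
pose e : {poly R} := \poly_(i < N.+1) deg_binom l 1 i.
have eE n : (n <= N)%N -> e`_n = deg_binom l 1 n.
  by move=> nN; rewrite coef_poly ltnS nN.
(* By the binomial theorem for [(1 - p) + p e = u + 1], the polynomial [(u + 1) ^+ m] agrees with
   [f] up to degree [N]. *)
pose u := p *: (e - 1).
have uE j : (u ^+ j)`_N =
    if (j <= N)%N then p ^+ j * (j`!%:R * S N j / N`!%:R) else 0.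
  rewrite exprZn coefZ (deg_stirling2_coef l S)//.
  by case: ifP; rewrite ?mulr0.
have FE n : (n <= N)%N -> ((u + 1) ^+ m)`_n = f n.
  move=> nN; rewrite fE (_ : u + 1 = (1 - p)%:P + p *: e); last first.
    by rewrite /u scalerBr polyCB -[p *: 1]/(p%:A) alg_polyC polyC1; ring.
  rewrite exprDn coef_sum; apply: eq_bigr => i _.
  rewrite coefMn -rmorphXn coefCM exprZn coefZ (coef_deg_binom_exp l N)//.
  by rewrite /binomial_pmf /onem mulrnAl; congr (_ *+ _); ring.
pose F := (u + 1) ^+ m.
have F1E n : (n <= N)%N -> (F - 1)`_n = fps_sub1 f n.
  by move=> nN; rewrite coefB FE// coef1 /fps_sub1 /fps_Xn.
have powE j : fps_exp (fps_sub1 f) j N = ((F - 1) ^+ j)`_N.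
  exact: (coef_fps_exp _ N).
rewrite /fps_powr (gbinom_sum_eq m (fun j => fps_exp (fps_sub1 f) j N)
  (fun j => (u ^+ j)`_N)) => [|i].
  rewrite mulr_sumr; apply: eq_bigr => j _.
  rewrite uE -ltnS ltn_ord; field.
  by rewrite pnatr_eq0 -lt0n fact_gt0.
under eq_bigr do rewrite powE.
(* For a natural exponent [i], the sums are stretched to [j <= i] and [j <= m * i]. They become the
   full expansions of [F ^+ i] and [(u + 1) ^+ (m * i)], which are equal. *)
rewrite -(sum_bin_trunc (fun j => ((F - 1) ^+ j)`_N)); last first.
  by move=> j Nj; rewrite -powE fps_exp_sub1_small.
rewrite -(sum_bin_trunc (fun j => (u ^+ j)`_N)).
  by rewrite -!coef_expD1n subrK exprM.
by move=> j Nj; rewrite uE leqNgt Nj.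
Qed.

(** * Expectations under the binomial law *)

Lemma ge0_integral_binomial_rv {d : measure_display} {T : measurableType d}
    {R : realType} (P : probability T R) (Y : {RV P >-> R}) m (p : R)
    (g : R -> \bar R) :
  0 <= p <= 1 -> binomial_rv Y m p ->
  measurable_fun setT g -> (forall y, 0 <= g y)%E ->
  (\int[P]_w g (Y w) = \sum_(i < m.+1) (binomial_pmf m p i)%:E * g i%:R)%E.
Proof.
move=> /andP[p0 p1] YB mg g0.
rewrite -(ge0_integral_distribution Y mg g0).
have mnat : measurable_fun [set: nat] (fun i : nat => i%:R : R) by [].
(* [binomial_rv] says exactly that the law of [Y] is this image measure, so the integral moves to
   [nat]. *)
rewrite (eq_measure_integral (pushforward (binomial_prob m p)
    (fun i : nat => i%:R : R))); last by move=> A mA _; exact: YB.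
rewrite ge0_integral_pushforward//= preimage_setT.
by rewrite (@integral_binomial _ m p p0 p1).
Qed.

(** The nonnegative case applies to the positive and negative parts of [g]; both integrals are
    finite sums, so their difference makes sense. *)
Lemma expectation_binomial_rv {d : measure_display} {T : measurableType d}
    {R : realType} (P : probability T R) (Y : {RV P >-> R}) m (p : R)
    (g : R -> R) :
  0 <= p <= 1 -> binomial_rv Y m p -> measurable_fun setT g ->
  ('E_P[g \o Y] = (\sum_(i < m.+1) binomial_pmf m p i * g i%:R)%:E)%E.
Proof.
move=> p01 YB mg.
have mEg : measurable_fun setT (EFin \o g) by exact/measurable_EFinP.
rewrite unlock.
have -> : (\int[P]_w ((g \o Y) w)%:E =
    \int[P]_w (EFin \o g)^\+ (Y w) - \int[P]_w (EFin \o g)^\- (Y w))%E.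
  rewrite integralE; congr (_ - _)%E; apply: eq_integral => w _.
  - by rewrite !funeposE.
  - by rewrite !funenegE.
rewrite (ge0_integral_binomial_rv P Y m p (EFin \o g)^\+%E)//; last first.
  exact: measurable_funepos.
rewrite (ge0_integral_binomial_rv P Y m p (EFin \o g)^\-%E)//; last first.
  exact: measurable_funeneg.
rewrite !funerpos funerneg.
rewrite !sumEFin -EFinB; congr EFin.
rewrite -sumrB; apply: eq_bigr => i _.
by rewrite -mulrBr -[in RHS](funrposBneg g).
Qed.

Lemma measurable_deg_fallfact {R : realType} (l : R) n :
  measurable_fun setT (fun y => deg_fallfact l y n).
Proof.
rewrite /deg_fallfact.
apply: measurable_prod => i _.
exact: measurable_funB.
Qed.

Lemma fps_mul_Xn {R : realType} (f : nat -> R) k n : (k <= n)%N ->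
  fps_mul (fps_Xn k) f n = f (n - k)%N.
Proof.
move=> kn; have kn1 : (k < n.+1)%N by [].
rewrite /fps_mul (bigD1 (Ordinal kn1))//= /fps_Xn eqxx mul1r big1 ?addr0//.
by move=> i; rewrite -val_eqE/= => /negbTE ->; rewrite mul0r.
Qed.

Lemma deg_expectation_binomial {d : measure_display} {T : measurableType d}
    {R : realType} (P : probability T R) (Y : {RV P >-> R}) m (p l : R) n :
  0 <= p <= 1 -> binomial_rv Y m p ->
  deg_expectation Y l n =
  \sum_(i < m.+1) binomial_pmf m p i * deg_binom l i%:R n.
Proof.
move=> p01 YB; rewrite /deg_expectation.
have := expectation_binomial_rv P Y m p _ p01 YB (measurable_deg_fallfact l n).
rewrite /comp => -> /=.
by rewrite mulr_suml; apply: eq_bigr => i _; rewrite mulrA.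
Qed.

Theorem theorem2p11 (R : realType) (d : measure_display) (T : measurableType d)
    (P : probability T R) (Y : {RV P >-> R}) (m : nat) (p : R)
    (lambda x : R) (S2 : nat -> nat -> R) (n k : nat) :
  0 < p <= 1 ->
  binomial_rv Y m p ->
  0 <= x <= 1 ->
  deg_stirling2 lambda S2 ->
  (k <= n)%N ->
  deg_bernstein Y lambda k n x / k`!%:R =
  'C(n, k)%:R * deg_binom lambda x k
  * \sum_(j < (n - k).+1)
      gbinom (m%:R * (1 - x)) j * j`!%:R * p ^+ j * S2 (n - k)%N j.
Proof.
move=> /andP[p0 p1] YB _ SP kn.
have p01 : 0 <= p <= 1 by rewrite ltW.
rewrite -(coef_fps_powr_binomial lambda p S2 m (deg_expectation Y lambda))//.
(* The factor [t^k] shifts the coefficient index from [n] to [n - k]; the factorials match by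
   [n! = 'C(n, k) k! (n - k)!]. *)
- rewrite /deg_bernstein /deg_bernstein_gf fps_mul_Xn// -(bin_fact kn) !natrM.
  rewrite /deg_binom; field.
  by rewrite pnatr_eq0 -lt0n fact_gt0.
- by move=> i; exact: deg_expectation_binomial.
- exact: deg_expectation0.
Qed.
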